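(* Let $n$ be a positive integer. Then $$\min\{W(T) - \varepsilon(T):\ T \text{ is a tree with } n(T) = n\}$$ is achieved on a caterpillar; that is, there is a caterpillar $T_0$ of order $n$ such that $W(T_0)-\varepsilon(T_0)\le W(T)-\varepsilon(T)$ for every tree $T$ of order $n$.
   Context: Graphs are finite and simple; $n(T)$ is the number of vertices of $T$ (its order). $d_T(u,v)$ is the number of edges on the $u,v$-path. The Wiener index is $W(T)=\sum_{\{u,v\}\subseteq V(T)} d_T(u,v)$ (sum over unordered pairs of vertices). The eccentricity of a vertex $v$ is $\varepsilon_T(v)=\max_{u\in V(T)} d_T(v,u)$, and the eccentricity of the tree is $\varepsilon(T)=\sum_{v\in V(T)}\varepsilon_T(v)$. A tree is a caterpillar if it contains a (diametrical) path such that every vertex not on the path is at distance $1$ from it. *)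

(* Defs.v *)
From mathcomp Require Import all_boot all_order all_algebra.

Set Implicit Arguments.
Unset Strict Implicit.
Unset Printing Implicit Defensive.

Record sgraph := SGraph {
  vertex :> finType;
  edge : rel vertex;
  edge_sym : symmetric edge;
  edge_irrefl : irreflexive edge }.

Definition graph_order (G : sgraph) : nat := #|G|.

Definition connected (G : sgraph) : Prop :=
  forall u v : G, connect (@edge G) u v.

(* The length is at least 3 because an edge traversed back and forth is an
   [ucycle] of length 2 of the symmetric relation [edge]. *)
Definition acyclic (G : sgraph) : Prop :=
  forall c : seq G, 2 < size c -> ~ ucycle (@edge G) c.

Definition tree (G : sgraph) : Prop :=
  [/\ 0 < graph_order G, connected G & acyclic G].

(* As in [path], the vertices of the path are [u :: p], so that its number of
   edges is [size p]. *)
Definition upath (G : sgraph) (u v : G) (p : seq G) : bool :=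
  [&& path (@edge G) u p, last u p == v & uniq (u :: p)].

(* The least length of a u,v-path; in a tree there is only one such path.
   The value is [graph_order G] when there is no u,v-path. *)
Definition dist (G : sgraph) (u v : G) : nat :=
  find (fun k => [exists p : k.-tuple G, upath u v p]) (iota 0 (graph_order G)).

(* Comparing ranks in the enumeration of the vertices selects each unordered
   pair of distinct vertices exactly once. *)
Definition wiener (G : sgraph) : nat :=
  \sum_(u : G) \sum_(v : G | enum_rank u < enum_rank v) dist u v.

Definition vertex_ecc (G : sgraph) (v : G) : nat := \max_(u : G) dist v u.

Definition eccentricity (G : sgraph) : nat := \sum_(v : G) vertex_ecc v.

Definition diameter (G : sgraph) : nat := \max_(v : G) vertex_ecc v.

Definition diametrical_path (G : sgraph) (u : G) (p : seq G) : Prop :=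
  upath u (last u p) p /\ size p = diameter G.

Definition caterpillar (G : sgraph) : Prop :=
  tree G /\
  exists (u : G) (p : seq G), diametrical_path u p /\
    forall v : G, v \notin u :: p -> exists2 w : G, w \in u :: p & dist v w = 1.

(* The difference is negative for small trees, hence the values in [int]. *)
Definition wiener_minus_ecc (G : sgraph) : int :=
  ((wiener G)%:Z - (eccentricity G)%:Z)%R.

(* Main.v *)
(** A minimiser [T] exists by well-ordering; suppose that it is not a
    caterpillar. Let [P] be a diametrical path with ends [a], [b] and [D] edges,
    [m] the number of vertices off [P], and [s v] the sum over [x] of
    [(dist v x - 2)^+]. Since [T] has [n - 1] edges, twice its Wiener index is
    [2n^2 - 4n + 2 + sum_v s v]. Every vertex satisfies [2 ecc v <= 5 + s v],
    by looking at a longest path from [v]. For [a] and [b] much more is true: a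
    vertex at distance [k] from [P] has [dist a x + dist b x = D + 2k], so
    [s a + s b >= (D - 1)(D - 2) + m(D - 2) + 2], where the last [2] comes from
    a vertex with [k >= 2], which also forces [D >= 4] and [m >= 2]. Adding up
    yields [W - ecc > n^2 - 4n]. But the star with one subdivided edge attains
    [n^2 - 4n], a contradiction. *)
Require Import Defs.
From Stdlib Require Import Classical.
From mathcomp Require Import all_boot all_order all_algebra.
From mathcomp Require Import zify.

Set Implicit Arguments.
Unset Strict Implicit.
Unset Printing Implicit Defensive.

(** * Paths, and distance as the length of the unique path in an acyclic graph *)

Section Paths.
Variable G : sgraph.
Implicit Types (u v w x : G) (p q : seq G).

Lemma upath_size u v p : upath u v p -> size p < graph_order G.
Proof.
case/and3P=> _ _ /card_uniqP; rewrite /graph_order.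
by rewrite -[size p < _]/(size (u :: p) <= _) => <-; exact: max_card.
Qed.

Lemma upath_nil u v : upath u v [::] = (u == v).
Proof. by rewrite /upath /= andbT. Qed.

Lemma upath_last u v p : upath u v p -> v \in u :: p.
Proof. by case/and3P=> _ /eqP <- _; exact: mem_last. Qed.

Lemma upath_refl u p : upath u u p -> p = [::].
Proof.
case: p => // x p /and3P[_ /= /eqP l]; rewrite -/(uniq (x :: p)).
by rewrite -{1}l mem_last.
Qed.

Lemma edge_neq u v : edge u v -> u != v.
Proof. by apply: contraTneq => ->; rewrite edge_irrefl. Qed.

Lemma upath_edge u v : edge u v -> upath u v [:: v].
Proof. by move=> e; rewrite /upath /= e eqxx inE edge_neq. Qed.

Lemma upath_cat u w v p q :
    upath u w p -> upath w v q -> {in q, forall x, x \notin u :: p} ->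
  upath u v (p ++ q).
Proof.
case/and3P=> pp /eqP lp up /and3P[pq /eqP lq /= /andP[_ uq]] dpq.
rewrite /upath cat_path last_cat lp pp pq lq eqxx -cat_cons cat_uniq up uq.
by rewrite !andbT; apply/hasPn => x /dpq.
Qed.

Lemma upath_rcons u w v p :
  upath u w p -> edge w v -> v \notin u :: p -> upath u v (rcons p v).
Proof.
move=> Hp e nv; rewrite -cats1; apply: (upath_cat Hp (upath_edge e)) => x.
by rewrite inE => /eqP->.
Qed.

Lemma upath_catE u v p q :
  upath u v (p ++ q) -> upath u (last u p) p /\ upath (last u p) v q.
Proof.
rewrite {1}/upath cat_path last_cat -cat_cons cat_uniq.
case/and3P=> /andP[pp pq] lq /and3P[up d /= uq].
rewrite /upath pp pq lq up eqxx /= uq andbT; split=> //.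
by apply: contra d => lq2; apply/hasP; exists (last u p); rewrite ?mem_last.
Qed.

Lemma upath_split u v w p :
    upath u v p -> w \in u :: p ->
  exists p1 p2, [/\ p = p1 ++ p2, upath u w p1 & upath w v p2].
Proof.
move=> Hp /splitPl wp; case: wp Hp => p1 p2 lp /upath_catE[].
by rewrite lp => H1 H2; exists p1, p2.
Qed.

Lemma upath_rev u v p : upath u v p -> upath v u (rev (belast u p)).
Proof.
case/and3P=> pp /eqP lp up; apply/and3P; split.
- by rewrite -lp rev_path; apply: sub_path pp => x y; rewrite edge_sym.
- by case: p pp lp up => [_ /= ->|x p _ _ _] //; rewrite /= rev_cons last_rcons.
- by rewrite -lp -rev_rcons -lastI rev_uniq.
Qed.

(** Cutting at the first vertex in [A] leaves an initial piece that avoids [A] before its end; this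
    supplies the disjointness needed by [upath_cat]. *)
Lemma upath_first_hit (A : {pred G}) u v p :
    upath u v p -> has (mem A) (u :: p) ->
  exists w p1 p2, [/\ p = p1 ++ p2, upath u w p1, upath w v p2, w \in A &
    {in u :: p1, forall z, z \in A -> z = w}].
Proof.
move=> Hp; move E: (u :: p) => s hA; case: (split_find hA) E => w p1 p2 Aw nA.
have hit z : z \in rcons p1 w -> z \in A -> z = w.
  by rewrite mem_rcons inE => /predU1P[//|zp Az]; case/hasP: nA; exists z.
move=> E; case: p1 nA hit E => [|u1 p1] nA hit [uE pE].
  exists w, [::], p; split; rewrite ?upath_nil ?uE // -?uE //.
have /upath_catE[] : upath u v (rcons p1 w ++ p2) by rewrite -pE.
rewrite last_rcons => H1 H2; exists w, (rcons p1 w), p2; split=> // z zp.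
by apply: hit; rewrite /= -uE.
Qed.

Lemma acyclic_edge u v p :
  acyclic G -> upath u v p -> edge v u -> size p <= 1.
Proof.
move=> acG /and3P[pp /eqP lp up] e; rewrite leqNgt; apply/negP => sp.
by apply: (acG (u :: p)) => //; rewrite /ucycle /= rcons_path pp lp e.
Qed.

Lemma upath_uniq u v p q : acyclic G -> upath u v p -> upath u v q -> p = q.
Proof.
move=> acG; elim: p u q => [|x p IHp] u [|y q] //.
- by rewrite upath_nil => /eqP<- /upath_refl.
- by move=> + /[1!upath_nil] /eqP e; rewrite e => /upath_refl.
move=> Hp Hq; have [_ Hp'] := @upath_catE u v [:: x] p Hp.
have [_ Hq'] := @upath_catE u v [:: y] q Hq; rewrite /= in Hp' Hq'.
have [xy|xy] := eqVneq x y; first by subst y; rewrite (IHp x q).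
(* Following [p] until it first hits [q] and returning along [q] to [y] closes a
   cycle through [u] with distinct neighbours [x] and [y]. *)
have hasw : has (mem (y :: q)) (x :: p).
  by apply/hasP; exists v; [exact: upath_last Hp' | exact: upath_last Hq'].
have [w [p1 [p2 [pE H1 _ wq nq]]]] := upath_first_hit Hp' hasw.
have [q1 [q2 [qE K1 _]]] := upath_split Hq' wq.
have /and3P[_ /eqP lp1 _] := H1; have /and3P[_ /eqP lq1 uq1] := K1.
have [Hxw _] : upath u w (x :: p1) /\ upath w v p2.
  by rewrite -lp1; apply: (@upath_catE u v (x :: p1) p2); rewrite /= -pE.
have /and3P[_ _ /andP[uq2 _]] := Hq.
have /acyclic_edge : upath u y ((x :: p1) ++ rev (belast y q1)).
  apply: (upath_cat Hxw (upath_rev K1)) => z; rewrite mem_rev => zq1.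
  have zq : z \in y :: q1 by exact: mem_belast.
  have zyq : z \in y :: q by rewrite qE -cat_cons mem_cat zq.
  rewrite inE negb_or; apply/andP; split.
    by apply: contraNneq uq2 => <-.
  apply/negP => /nq /(_ zyq) zw; move: uq1.
  by rewrite lastI rcons_uniq lq1 -zw zq1.
rewrite edge_sym; case/and3P: Hq => /andP[-> _] _ _ /(_ acG isT).
rewrite size_cat size_rev size_belast /=.
case: p1 lp1 {pE H1 nq Hxw} => //= xw; case: q1 lq1 {qE K1 uq1} => //= yw _.
by rewrite xw yw eqxx in xy.
Qed.

Lemma dist_leq u v p : upath u v p -> dist u v <= size p.
Proof.
move=> Hp; rewrite leqNgt; apply/negP => lt_p.
have := before_find 0 lt_p; rewrite nth_iota ?(upath_size Hp) // add0n.
by move/existsP; apply; exists (in_tuple p).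
Qed.

Lemma dist_upath_ex u v p :
  upath u v p -> exists2 q, upath u v q & size q = dist u v.
Proof.
move=> Hp; set a := fun k => [exists p : k.-tuple G, upath u v p].
have ha : has a (iota 0 (graph_order G)).
  apply/hasP; exists (size p); last by apply/existsP; exists (in_tuple p).
  by rewrite mem_iota (upath_size Hp).
have := nth_find 0 ha; rewrite nth_iota; last first.
  by rewrite -{2}[graph_order G](size_iota 0) -has_find.
by case/existsP=> q Hq; exists q; rewrite ?size_tuple.
Qed.

Lemma dist_upath u v p : acyclic G -> upath u v p -> dist u v = size p.
Proof.
move=> acG Hp; have [q Hq <-] := dist_upath_ex Hp.
by rewrite (upath_uniq acG Hp Hq).
Qed.

Lemma upath_ex u v : connected G -> exists p, upath u v p.
Proof.
move=> /(_ u v) /connectP[p pp ->]; case: (shortenP pp) => q pq uq _.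
by exists q; apply/and3P.
Qed.

Lemma dist_le_order u v : dist u v <= graph_order G.
Proof. by rewrite -[leqRHS](size_iota 0) find_size. Qed.

Lemma distxx u : dist u u = 0.
Proof.
by apply/eqP; rewrite -leqn0; apply: (@dist_leq _ _ [::]); rewrite upath_nil.
Qed.

End Paths.

(** * Distances and the number of edges in a tree *)

Section Tree.
Variables (G : sgraph) (trG : tree G).
Implicit Types (u v w x : G) (p q : seq G).

Let conG : connected G. Proof. by case: trG. Qed.
Let acG : acyclic G. Proof. by case: trG. Qed.

Lemma dist_sym u v : dist u v = dist v u.
Proof.
have [p Hp] := upath_ex u v conG.
rewrite (dist_upath acG Hp) (dist_upath acG (upath_rev Hp)).
by rewrite size_rev size_belast.
Qed.

Lemma dist_eq0 u v : (dist u v == 0) = (u == v).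
Proof.
have [p Hp] := upath_ex u v conG; rewrite (dist_upath acG Hp).
apply/idP/eqP => [/nilP p0|uv]; first by apply/eqP; rewrite -upath_nil -p0.
by rewrite uv in Hp; rewrite (upath_refl Hp).
Qed.

Lemma dist_eq1 u v : (dist u v == 1) = edge u v.
Proof.
apply/idP/idP => [|e].
  have [p Hp] := upath_ex u v conG; rewrite (dist_upath acG Hp).
  by case: p Hp => [|x []] // /and3P[/= /andP[e _] /eqP<-].
by rewrite (dist_upath acG (upath_edge e)).
Qed.

Lemma dist_path_mem u v p x :
  upath u v p -> x \in u :: p -> dist u x + dist x v = size p.
Proof.
move=> Hp /(upath_split Hp)[p1 [p2 [-> H1 H2]]].
by rewrite (dist_upath acG H1) (dist_upath acG H2) size_cat.
Qed.

(** Either [v] lies on the path from [r] to [u] and is closer to [r], or appending [v] to that path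
    makes it farther by one. *)
Lemma dist_edge r u v : edge u v -> dist r u != dist r v.
Proof.
move=> e; have [p Hp] := upath_ex r u conG.
have uv := edge_neq e.
have [vp|vp] := boolP (v \in r :: p).
  have := dist_path_mem Hp vp; rewrite -(dist_upath acG Hp) => <-.
  by rewrite -{2}[dist r v]addn0 eqn_add2l dist_eq0 eq_sym.
rewrite (dist_upath acG (upath_rcons Hp e vp)) size_rcons.
by rewrite (dist_upath acG Hp) neq_ltn ltnSn.
Qed.

(** A path from [r] to a closer neighbour of [v] misses [v], so it extends to the unique path from
    [r] to [v], which determines the neighbour. *)
Lemma closer_neighbour_uniq r u1 u2 v :
  edge v u1 -> dist r u1 < dist r v -> edge v u2 -> dist r u2 < dist r v ->
  u1 = u2.
Proof.
have ext u : edge v u -> dist r u < dist r v ->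
    exists2 p, upath r v (rcons p v) & last r p = u.
  move=> e lt; have [p Hp] := upath_ex r u conG; exists p.
    apply: (upath_rcons Hp); first by rewrite edge_sym.
    apply: contraTN lt => vp; rewrite -leqNgt (dist_upath acG Hp).
    by rewrite -(dist_path_mem Hp vp) leq_addr.
  by case/and3P: Hp => _ /eqP.
move=> e1 l1 e2 l2.
have [p1 H1 <-] := ext _ e1 l1; have [p2 H2 <-] := ext _ e2 l2.
by have /rcons_inj[->] := upath_uniq acG H1 H2.
Qed.

Lemma sum_edges : \sum_u \sum_v (@edge G u v : nat) <= 2 * (graph_order G).-1.
Proof.
have [r _] : exists r : G, true.
  by case: trG => /card_gt0P[r _]; exists r.
(* Rooted at [r], each edge is counted at its endpoint farther from [r]. *)
pose c u v := edge u v && (dist r v < dist r u).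
have -> : \sum_u \sum_v (@edge G u v : nat) =
    \sum_u \sum_v (c u v : nat) + \sum_u \sum_v (c v u : nat).
  rewrite -big_split; apply: eq_bigr => u _.
  rewrite -big_split; apply: eq_bigr => v _.
  rewrite /c (edge_sym v u); case e: (edge u v) => //=.
  by have := dist_edge r e; rewrite neq_ltn; case: ltngtP.
rewrite [X in _ + X]exchange_big addnn -mul2n leq_mul2l /=.
have -> : (graph_order G).-1 = \sum_(u | u != r) 1.
  by rewrite sum1_card /graph_order -(cardC1 r); apply: eq_card.
rewrite [leqLHS](bigD1 r) //= big1 ?add0n => [|v _]; last first.
  by rewrite /c distxx ltn0 andbF.
apply: leq_sum => u _; have [v0 c0|c0] := pickP (c u); last first.
  by rewrite big1 // => v _; rewrite c0.
rewrite (bigD1 v0) //= big1 ?addn0 ?leq_b1 // => v vv0.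
apply/eqP; rewrite eqb0; apply: contraNN vv0 => /andP[e l]; apply/eqP.
by case/andP: c0 => e0 l0; apply: (closer_neighbour_uniq e l e0 l0).
Qed.

End Tree.

(** Twice the sum is [(D - 1) * (D - 2)], rearranged to avoid truncated subtraction; the formula
    fails at [D = 0]. *)
Lemma double_sum_excess D : 0 < D ->
  2 * (\sum_(k < D.+1) (k - 2)) + 3 * D = D ^ 2 + 2.
Proof.
elim: D => // -[|D] IHD _; first by rewrite !big_ord_recl big_ord0.
rewrite big_ord_recr /= mulnDr; have := IHD isT; rewrite -!mulnn.
by move: (\sum_(k < _) _) => S; lia.
Qed.

(** For positive [e] this amounts to [(e - 3) * (e - 4) >= 0], with equality at 3 and 4; hence the
    constant 5. *)
Lemma double_le_sum_excess e : 2 * e <= 5 + \sum_(k < e.+1) (k - 2).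
Proof.
case: e => // e; have := @double_sum_excess e.+1 isT; rewrite -mulnn.
by move: (\sum_(k < _) _) => S; have [|] := leqP e 2; nia.
Qed.

(** * Sums of distances and a lower bound for the Wiener index *)

Section TreeSums.
Variables (G : sgraph) (trG : tree G).
Implicit Types (u v w x : G) (p q : seq G).

Let conG : connected G. Proof. by case: trG. Qed.
Let acG : acyclic G. Proof. by case: trG. Qed.

(** [w] is where the path from [u] to [a] first meets [a :: p]; the path from [u] to [b] turns along
    [p] at the same vertex. *)
Lemma path_projection a b p u : upath a b p ->
  exists2 w, w \in a :: p &
    dist u a = dist u w + dist w a /\ dist u b = dist u w + dist w b.
Proof.
move=> Hp; have [q Hq] := upath_ex u a conG.
have hasq : has (mem (a :: p)) (u :: q).
  by apply/hasP; exists a; [exact: upath_last Hq | rewrite /= mem_head].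
have [w [q1 [q2 [qE H1 H2 wp nq]]]] := upath_first_hit Hq hasq.
have wq : w \in u :: q by rewrite qE -cat_cons mem_cat (upath_last H1).
exists w => //; split.
  by rewrite (dist_path_mem trG Hq wq) (dist_upath acG Hq).
have [p1 [p2 [pE K1 K2]]] := upath_split Hp wp.
rewrite (dist_upath acG H1) (dist_upath acG K2) -size_cat.
apply/dist_upath => //; apply: (upath_cat H1 K2) => x xp2; apply/negP => /nq.
rewrite pE -cat_cons mem_cat xp2 orbT => /(_ isT) xw.
by case/and3P: K2 => _ _ /andP[/negP[]]; rewrite -xw.
Qed.

Lemma sum_upath (F : nat -> nat) u v p :
  upath u v p -> \sum_(x <- u :: p) F (dist u x) = \sum_(k < (size p).+1) F k.
Proof.
elim/last_ind: p v => [|p x IHp] v Hp.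
  by rewrite big_seq1 big_ord1 distxx.
have [Hp' _] : upath u (last u p) p /\ upath (last u p) v [:: x].
  by apply: upath_catE; rewrite cats1.
rewrite -cats1 -cat_cons big_cat (IHp _ Hp') big_seq1 cats1 size_rcons.
rewrite [RHS]big_ord_recr /=; congr (_ + F _).
have /and3P[_ /eqP] := Hp; rewrite last_rcons => xv _.
by rewrite xv (dist_upath acG Hp) size_rcons.
Qed.

(** The vertices of the path from [u] to [v] alone contribute the left-hand side. *)
Lemma sum_dist_ge (F : nat -> nat) u v :
  \sum_(k < (dist u v).+1) F k <= \sum_x F (dist u x).
Proof.
have [p Hp] := upath_ex u v conG; rewrite (dist_upath acG Hp) -(sum_upath F Hp).
have /and3P[_ _ up] := Hp; rewrite big_uniq //=.
by rewrite [leqRHS](bigID [in u :: p]) /= leq_addr.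
Qed.

Lemma vertex_eccE u : exists v, vertex_ecc u = dist u v.
Proof. by have [|v] := @eq_bigmax G (dist u); [case: trG | exists v]. Qed.

Lemma double_ecc_le v : 2 * vertex_ecc v <= 5 + \sum_u (dist v u - 2).
Proof.
have [u ->] := vertex_eccE v; apply: leq_trans (double_le_sum_excess _) _.
by rewrite leq_add2l (sum_dist_ge (fun k => k - 2)).
Qed.

Lemma double_wiener : 2 * wiener G = \sum_(u : G) \sum_v dist u v.
Proof.
rewrite mul2n -addnn {2}/wiener.
have -> : \sum_(u : G) \sum_(v : G | enum_rank u < enum_rank v) dist u v
   = \sum_u \sum_(v : G | enum_rank v < enum_rank u) dist u v.
  rewrite (exchange_big_dep xpredT) //=.
  by apply: eq_bigr => u _; apply: eq_bigr => v _; apply: dist_sym.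
rewrite -big_split; apply: eq_bigr => u _ /=.
rewrite [RHS](bigID (fun v => enum_rank u < enum_rank v)) /=; congr addn.
rewrite [RHS](bigD1 u) ?ltnn //= distxx add0n; apply: eq_bigl => v.
by rewrite -leqNgt ltn_neqAle andbC (inj_eq val_inj) (inj_eq enum_rank_inj).
Qed.

(** For each ordered pair at distance [d], [2 + (d - 2)] is [d], plus 2 if [d = 0], plus 1 if
    [d = 1]. These corrections total [2n] on the diagonal and at most [2(n - 1)] on the edges. *)
Lemma wiener_ge :
  2 * graph_order G ^ 2 + \sum_(u : G) \sum_(v : G) (dist u v - 2)
    <= 2 * wiener G + 2 * graph_order G + 2 * (graph_order G).-1.
Proof.
set n := graph_order G.
rewrite double_wiener.
have n2E : 2 * n = \sum_(u : G) \sum_v 2 * (u == v).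
  rewrite -mulnC -sum_nat_const; apply: eq_big => // u _.
  by rewrite (bigD1 u) //= eqxx big1 // => v /negPf vu; rewrite eq_sym vu.
have -> : 2 * n ^ 2 = \sum_(u : G) \sum_(v : G) 2.
  by rewrite !sum_nat_const -[#|_|]/n -mulnn; lia.
apply: leq_trans (leq_add (leqnn _) (sum_edges trG)).
rewrite n2E -!big_split; apply: leq_sum => u _ /=.
rewrite -!big_split; apply: leq_sum => v _ /=.
rewrite -dist_eq0 // -dist_eq1 //; lia.
Qed.

End TreeSums.

Lemma sum_eq_mul (T : finType) (a : T) (F : T -> nat) :
  \sum_v (v == a) * F v = F a.
Proof.
by rewrite (bigD1 a) //= eqxx mul1n big1 ?addn0 // => v /negPf->.
Qed.

(** * The lower bound for trees that are not caterpillars *)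

Section NonCaterpillar.
Variables (G : sgraph) (trG : tree G).
Implicit Types (u v w x : G) (p q : seq G).

Let conG : connected G. Proof. by case: trG. Qed.
Let acG : acyclic G. Proof. by case: trG. Qed.

Lemma dist_le_ecc u v : dist u v <= vertex_ecc u.
Proof. exact: (leq_bigmax (F := dist u)). Qed.

Lemma ecc_le_diameter u : vertex_ecc u <= diameter G.
Proof. exact: (leq_bigmax (F := @vertex_ecc G)). Qed.

Lemma diametrical_path_ex :
  exists a b p, upath a b p /\ size p = diameter G.
Proof.
have [|a dE] := @eq_bigmax G (@vertex_ecc G); first by case: trG.
have [b eE] := vertex_eccE trG a; have [p Hp] := upath_ex a b conG.
by exists a, b, p; rewrite -(dist_upath acG Hp) -eE.
Qed.

Lemma off_path_excess a b p x k : upath a b p ->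
    (forall w, w \in a :: p -> k <= dist x w) ->
  size p + 2 * k <= dist a x + dist b x.
Proof.
move=> Hp far; have [w wp [Ea Eb]] := path_projection trG x Hp.
have := far w wp; have := dist_path_mem trG Hp wp.
rewrite (dist_sym trG a x) (dist_sym trG b x) Ea Eb (dist_sym trG w a).
by lia.
Qed.

(** A path vertex at distance [k] from [a] is at distance [size p - k] from [b], so index reversal
    gives two copies of the sum in [double_sum_excess]. *)
Lemma on_path_excess a b p : upath a b p -> 0 < size p ->
  size p ^ 2 + 2 = 3 * size p +
    \sum_(x in a :: p) ((dist a x - 2) + (dist b x - 2)).
Proof.
move=> Hp sp; have /and3P[_ _ up] := Hp.
rewrite -(big_uniq _ up) /=.
pose F k := (k - 2) + (size p - k - 2).
rewrite (eq_big_seq (fun x => F (dist a x))) => [|x xp].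
  rewrite (sum_upath trG F Hp) big_split /=.
  rewrite [X in _ + (_ + X)](reindex_inj rev_ord_inj) /=.
  under [X in _ + (_ + X)]eq_bigr => i _.
    rewrite subSS subKn; last by rewrite -ltnS. over.
  by have := double_sum_excess sp; move: (\sum_(k < _) _) => S <-; lia.
by rewrite /F -(dist_path_mem trG Hp xp) addKn (dist_sym trG b).
Qed.

(** The bound [6 < n] comes from [D >= 4] and [m >= 2]; it later guarantees that the comparison tree
    exists and has a leaf at its centre. *)
Lemma noncaterpillar_gap (n := graph_order G) :
  ~ caterpillar G -> 6 < n /\ n ^ 2 + eccentricity G < wiener G + 4 * n.
Proof.
move=> ncat; have [a [b [p [Hp sp]]]] := diametrical_path_ex.
have /and3P[_ /eqP lp up] := Hp.
have [u /andP[uNp /existsP uF]|H] :=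
    pickP (fun u => (u \notin a :: p) &&
                    ~~ [exists w in a :: p, dist u w == 1]); last first.
  case: ncat; split=> //; exists a, p; split.
    by rewrite /diametrical_path lp.
  move=> v vp; move/negbT: (H v); rewrite vp negbK.
  by case/existsP=> w /andP[wp /eqP]; exists w.
have far1 x : x \notin a :: p -> forall w, w \in a :: p -> 1 <= dist x w.
  move=> xp w wp; rewrite lt0n dist_eq0 //.
  by apply: contraNneq xp => ->.
have far2 w : w \in a :: p -> 2 <= dist u w.
  move=> wp; have := far1 u uNp w wp; rewrite leq_eqVlt => /orP[/eqP d1|//].
  by case: uF; exists w; rewrite wp -d1.
set D := size p in sp.
have uD := off_path_excess Hp far2.
(* [D + 4 <= dist a u + dist b u], and neither distance exceeds the diameter [D]. *)
have D4 : 4 <= D.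
  have := dist_le_ecc a u; have := dist_le_ecc b u.
  by have := ecc_le_diameter a; have := ecc_le_diameter b; lia.
pose m := #|[predC a :: p]|.
have nE : n = D.+1 + m.
  by rewrite /n /graph_order -(cardC (mem (a :: p))); move/card_uniqP: up => ->.
(* Besides [u], its neighbour towards [a] is off the path, since [u] is at distance at least 2 from
   it. *)
have m2 : 2 <= m.
  have [q Hq] := upath_ex u a conG.
  case: q Hq => [|x q Hq].
    by rewrite upath_nil => /eqP ua; rewrite ua mem_head in uNp.
  have exu : edge u x by case/and3P: Hq => /andP[].
  have xNp : x \notin a :: p.
    by apply/negP => /far2; rewrite leqNgt ltnS leq_eqVlt dist_eq1 ?exu.
  rewrite -(_ : #|[set u; x]| = 2); last by rewrite cards2 edge_neq.
  by apply: subset_leq_card; apply/subsetP => y /set2P[]->; rewrite inE.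
pose s v := \sum_x (dist v x - 2).
(* A vertex off the path contributes at least [D + 2 - 4], and [u] at least [D + 4 - 4]; the surplus
   2 is written as an indicator sum to compare term by term. *)
have sab : D ^ 2 + 2 + (m * (D - 2) + 2) <= 3 * D + (s a + s b).
  rewrite /s -big_split (bigID [in a :: p]) /=.
  have := on_path_excess Hp; rewrite -/D => ->; last by lia.
  rewrite -addnA !leq_add2l /m -sum_nat_const.
  rewrite -[X in _ + X](sum_eq_mul u (fun=> 2)).
  rewrite [X in _ + X](bigID [in a :: p]) /= [X in _ + (X + _)]big1 => [|x xp].
    rewrite add0n -big_split; apply: leq_sum => x xNp /=.
    have := off_path_excess Hp (far1 x xNp); rewrite -/D.
    by case: eqP => [->|_]; lia.
  by case: eqP => // xu; rewrite xu (negPf uNp) in xp.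
have ab : a != b.
  by rewrite -dist_eq0 // (dist_upath acG Hp) -lt0n -/D; lia.
(* At [a] and [b] the bound [2 * D] replaces that of [double_ecc_le]; the terms it displaces are
   added on the left rather than subtracted on the right. *)
have ecc_s : 2 * eccentricity G + (s a + 5 + (s b + 5)) <=
    5 * n + \sum_v s v + (2 * D + 2 * D).
  have [e2 -> e2E] : exists2 e2, 2 * eccentricity G = \sum_v e2 v
      & forall v : G, e2 v = 2 * vertex_ecc v.
    by exists (fun v => 2 * vertex_ecc v); rewrite // /eccentricity big_distrr.
  have : \sum_v (e2 v + ((v == a) * (s v + 5) + (v == b) * (s v + 5)))
      <= \sum_v (5 + s v + ((v == a) * (2 * D) + (v == b) * (2 * D))).
    apply: leq_sum => v _; have := double_ecc_le trG v; rewrite -/(s v).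
    have := ecc_le_diameter v; rewrite -sp e2E.
    by have [->|va] := eqVneq v a; [rewrite (negPf ab)|case: (v == b)]; lia.
  have s5 : \sum_(v : G) 5 = 5 * n by rewrite sum_nat_const mulnC.
  by rewrite !big_split /= !sum_eq_mul s5.
split; first lia.
have := wiener_ge trG; rewrite -/n -/s.
move: (\sum_v s v) (s a) (s b) ecc_s sab => S sa sb.
(* This amounts to [(D - 3) * (D - 5 + m) > 0]. *)
by rewrite nE -!mulnn; nia.
Qed.

End NonCaterpillar.

(** * Trees built from a parent function *)

Section ParentGraph.
Variables (V : finType) (r : V) (parent : V -> V) (depth : V -> nat).
Hypothesis depth_parent : forall v, v != r -> depth (parent v) < depth v.

(** The guards discard the value of [parent] at the root. *)
Definition parent_edge (u v : V) :=
  (u != r) && (parent u == v) || (v != r) && (parent v == u).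

Lemma parent_edge_sym : symmetric parent_edge.
Proof. by move=> u v; rewrite /parent_edge orbC. Qed.

Lemma parent_edge_irrefl : irreflexive parent_edge.
Proof.
move=> u; rewrite /parent_edge orbb; apply/negP.
by case/andP=> /depth_parent + /eqP E; rewrite E ltnn.
Qed.

Definition parent_graph : sgraph := SGraph parent_edge_sym parent_edge_irrefl.

Lemma parent_graph_connected : connected parent_graph.
Proof.
have symc := sym_connect_sym parent_edge_sym.
suff toroot (u : V) : connect parent_edge u r.
  by move=> u v; apply: (connect_trans (toroot u)); rewrite symc toroot.
have [k] := ubnP (depth u); elim: k u => // k IHk u lt_u.
have [->|ur] := eqVneq u r; first exact: connect0.
apply: (connect_trans (connect1 _) (IHk (parent u) _)).
  by rewrite /parent_edge ur eqxx.
exact: leq_trans (depth_parent ur) lt_u.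
Qed.

(* On a cycle, a vertex of maximal depth would have two distinct neighbours
   that are not deeper, whereas only its parent can be. *)
Lemma parent_graph_acyclic : acyclic parent_graph.
Proof.
case=> // v0 c0 sc Hc; set c := v0 :: c0 in sc Hc.
have v0c : v0 \in c by exact: mem_head.
case: (@arg_maxnP V v0 [in c] depth v0c) => v vc vmax.
have up w : w \in c -> parent_edge v w -> parent v = w.
  move=> /vmax /= wle /orP[/andP[_ /eqP]//|/andP[/depth_parent + /eqP E]].
  by rewrite E ltnNge wle.
have [i c' E] := rot_to vc.
have Hc' : ucycle parent_edge (v :: c') by rewrite -E rot_ucycle.
have sc' : 2 < size (v :: c') by rewrite -E size_rot.
have memc w : w \in v :: c' -> w \in c by rewrite -E mem_rot.
case: c' Hc' sc' memc {E} => [|x [|y c']] // /andP[].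
rewrite /cycle rcons_path /= => /andP[/andP[vx _] lv] /and3P[_ xNc' _] _ memc.
have lc : last y c' \in y :: c' by exact: mem_last.
have x1 : parent v = x by apply: up vx; rewrite memc // !inE eqxx orbT.
have x2 : parent v = last y c'.
  apply: up; last by rewrite parent_edge_sym.
  by apply: memc; do 2 rewrite inE; rewrite lc !orbT.
by rewrite -x1 x2 lc in xNc'.
Qed.

Lemma parent_graph_tree : tree parent_graph.
Proof.
split; [|exact: parent_graph_connected|exact: parent_graph_acyclic].
by apply/card_gt0P; exists r.
Qed.

End ParentGraph.

(** The star with centre [None]; it starts the descent to a minimiser. *)
Lemma tree_of_order n : 0 < n -> exists2 T : sgraph, tree T & graph_order T = n.
Proof.
move=> n0; pose depth (v : option 'I_n.-1) : nat := v != None.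
have dP v : v != None -> depth None < depth v by rewrite /depth => ->.
exists (parent_graph (parent := fun=> None) dP); first exact: parent_graph_tree.
by rewrite /graph_order card_option card_ord prednK.
Qed.

(** * The star with one subdivided edge *)

Section DoubleStar.
Variable m : nat.

Let V : finType := (unit + unit + unit + 'I_m)%type.
Let A : V := inl (inl (inl tt)).
Let B : V := inl (inl (inr tt)).
Let C : V := inl (inr tt).
Let L i : V := inr i.

(** The centre [A] carries the leaves [L i], and [B] subdivides the edge from [A] to the leaf
    [C]. *)
Definition double_star_parent (v : V) : V := if v == C then B else A.

Definition double_star_depth (v : V) : nat :=
  if v == A then 0 else if v == C then 2 else 1.

Lemma double_star_depth_parent v :
  v != A -> double_star_depth (double_star_parent v) < double_star_depth v.
Proof. by case: v => [[[[]|[]]|[]]|i]. Qed.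

Definition double_star : sgraph := parent_graph double_star_depth_parent.

Lemma double_star_tree : tree double_star.
Proof. exact: parent_graph_tree. Qed.

Lemma double_star_order : graph_order double_star = m + 3.
Proof. by rewrite /graph_order /= !card_sum !card_unit card_ord addnC. Qed.

Let acG : acyclic double_star. Proof. by case: double_star_tree. Qed.
Let dE (u v : double_star) p := @dist_upath double_star u v p acG.
Let dC (u v : double_star) := @dist_sym double_star double_star_tree u v.

Let dAB : @dist double_star A B = 1. Proof. exact: (dE (p := [:: B])). Qed.
Let dAC : @dist double_star A C = 2. Proof. exact: (dE (p := [:: B; C])). Qed.
Let dBC : @dist double_star B C = 1. Proof. exact: (dE (p := [:: C])). Qed.
Let dAL i : @dist double_star A (L i) = 1.
Proof. by apply: (dE (p := [:: L i])); rewrite /upath /= eqxx. Qed.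
Let dBL i : @dist double_star B (L i) = 2.
Proof. by apply: (dE (p := [:: A; L i])); rewrite /upath /= eqxx. Qed.
Let dCL i : @dist double_star C (L i) = 3.
Proof. by apply: (dE (p := [:: B; A; L i])); rewrite /upath /= eqxx. Qed.
Let dLL i j : i != j -> @dist double_star (L i) (L j) = 2.
Proof.
move=> ij; apply: (dE (p := [:: A; L j])); rewrite /upath /= eqxx /=.
by rewrite !inE /= andbT.
Qed.

Let sumV (F : V -> nat) : \sum_(v : V) F v = F A + F B + F C + \sum_i F (L i).
Proof.
have unitE (f : unit -> nat) : \sum_u f u = f tt.
  by rewrite (big_pred1 tt) // => -[].
by rewrite !big_sumType !unitE.
Qed.

Let sum_dLL i : \sum_j @dist double_star (L i) (L j) = 2 * m.-1.
Proof.
rewrite (bigD1 i) //= distxx add0n.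
under eq_bigr => j ji do rewrite dLL 1?eq_sym //.
by rewrite sum_nat_cond_const cardsE -[m in RHS]card_ord -(cardC1 i) mulnC.
Qed.

(** The distances from [A], [B], [C] sum to [m + 3], [2m + 2], [3m + 3], and those from each [L i]
    to [2m + 4]. *)
Lemma double_star_wiener : wiener double_star = m ^ 2 + 5 * m + 4.
Proof.
have rowL (i : 'I_m) :
    \sum_(v : V) @dist double_star (L i) v = 6 + 2 * m.-1.
  by rewrite sumV sum_dLL (dC _ A) (dC _ B) (dC _ C) dAL dBL dCL.
have := double_wiener double_star_tree.
rewrite sumV (eq_bigr _ (fun i _ => rowL i)) !sumV.
rewrite !(dC B A) !(dC C A) !(dC C B) !distxx dAB dAC dBC.
under [X in _ + X + _ + _ + _]eq_bigr => i _ do rewrite dAL.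
under [X in _ + (_ + X) + _ + _]eq_bigr => i _ do rewrite dBL.
under [X in _ + (_ + X) + _]eq_bigr => i _ do rewrite dCL.
by rewrite !sum_nat_const card_ord -mulnn; case: (m) => [|k]; nia.
Qed.

(** A lower bound suffices, as the eccentricity is subtracted; the leaf provided by [0 < m] serves
    as the far vertex for [B] and [C]. *)
Lemma double_star_ecc : 0 < m -> 3 * m + 7 <= eccentricity double_star.
Proof.
move=> m0; pose i0 := Ordinal m0; rewrite /eccentricity sumV.
have eA : 2 <= @vertex_ecc double_star A.
  by rewrite -dAC dist_le_ecc.
have eB : 2 <= @vertex_ecc double_star B by rewrite -(dBL i0) dist_le_ecc.
have eC : 3 <= @vertex_ecc double_star C by rewrite -(dCL i0) dist_le_ecc.
have eL : \sum_(i < m) 3 <= \sum_(i < m) @vertex_ecc double_star (L i).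
  by apply: leq_sum => i _; rewrite -(dCL i) dC dist_le_ecc.
have := leq_add (leq_add (leq_add eA eB) eC) eL.
by apply: leq_trans; rewrite sum_nat_const card_ord; lia.
Qed.
End DoubleStar.

(** [(m^2 + 5m + 4) - (3m + 7)] factors as [(m + 3)(m - 1)], that is, [n(n - 4)]. *)
Lemma double_star_gap m (n := m + 3) : 0 < m ->
  wiener (double_star m) + 4 * n <= n ^ 2 + eccentricity (double_star m).
Proof.
move=> /double_star_ecc; rewrite double_star_wiener /n -!mulnn; nia.
Qed.

(** * Existence of a minimiser, and the conclusion *)

Lemma wiener_minus_ecc_minimizer n : 0 < n ->
  exists T0 : sgraph, [/\ tree T0, graph_order T0 = n &
    forall T : sgraph, tree T -> graph_order T = n ->
      (wiener_minus_ecc T0 <= wiener_minus_ecc T)%R].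
Proof.
move=> /tree_of_order[T trT nT].
have ecc_le (G : sgraph) : graph_order G = n -> eccentricity G <= n ^ 2.
  move=> nG; rewrite -mulnn -{1}nG -sum_nat_const; apply: leq_sum => v _.
  by apply/bigmax_leqP => u _; rewrite -nG dist_le_order.
(* Since [n ^ 2] bounds the eccentricity, adding it keeps the subtraction exact in [nat], where
   descent terminates. *)
pose val G := wiener G + n ^ 2 - eccentricity G.
have [k] := ubnP (val T); elim: k T trT nT => // k IHk T trT nT lt_k.
have [[T' [trT' nT' lt']]|minT] := classic (exists T' : sgraph,
    [/\ tree T', graph_order T' = n & val T' < val T]).
  by apply: (IHk T') => //; exact: leq_trans lt' lt_k.
exists T; split=> // T' trT' nT'.
have : ~ val T' < val T by move=> lt'; apply: minT; exists T'.
have := ecc_le T nT; have := ecc_le T' nT'.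
by rewrite /val /wiener_minus_ecc; lia.
Qed.

Theorem theorem3p2 (n : nat) (hn : 0 < n) :
  exists T0 : sgraph, [/\ caterpillar T0, graph_order T0 = n
    & forall T : sgraph, tree T -> graph_order T = n ->
        (wiener_minus_ecc T0 <= wiener_minus_ecc T)%R].
Proof.
have [T0 [trT0 nT0 minT0]] := wiener_minus_ecc_minimizer hn.
exists T0; split=> //; apply: NNPP => ncat.
have [n7 gap] := noncaterpillar_gap trT0 ncat; rewrite nT0 in n7.
(* As [n >= 7], the truncated [n - 3] is exact, and positive as [double_star_gap] requires. *)
have n3E : n = n - 3 + 3 by lia.
have := @double_star_gap (n - 3); have := minT0 (double_star (n - 3)).
move=> /(_ (@double_star_tree _)); rewrite double_star_order -n3E => /(_ erefl).
move: gap; rewrite nT0 /wiener_minus_ecc; lia.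
Qed.
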